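(* Let $k>3$ and let $\mathcal F$ be a maximal unit $(n,k)$ equiangular tight frame in $\mathbb R^k$. Assume that $|\Lambda(\mathcal F)|=1$. Then the lattice $\Lambda(\mathcal F)$ is perfect and eutactic, and hence extreme.
   Context: $\langle\cdot,\cdot\rangle$ is the usual inner product on $\mathbb R^k$ and $\|\cdot\|$ the Euclidean norm. A set $\mathcal F=\{\boldsymbol f_1,\dots,\boldsymbol f_n\}\subset\mathbb R^k$ is an $(n,k)$ tight frame if $n>k$, $\operatorname{span}_{\mathbb R}\{\boldsymbol f_1,\dots,\boldsymbol f_n\}=\mathbb R^k$, and there is a real $\gamma>0$ such that $\|\boldsymbol x\|^2=\gamma\sum_{i=1}^n\langle\boldsymbol f_i,\boldsymbol x\rangle^2$ for every $\boldsymbol x\in\mathbb R^k$. A unit $(n,k)$ equiangular tight frame (ETF) of angle $c\in(0,1)$ is an $(n,k)$ tight frame consisting of unit vectors such that $|\langle\boldsymbol f_i,\boldsymbol f_j\rangle|=c$ for all $1\le i\ne j\le n$. Every unit $(n,k)$ ETF satisfies Gerzon's bound $k<n\le k(k+1)/2$; it is called maximal if $n=k(k+1)/2$. Put $\Lambda(\mathcal F)=\operatorname{span}_{\mathbb Z}\{\boldsymbol f_1,\dots,\boldsymbol f_n\}$. A lattice is a discrete additive subgroup of $\mathbb R^k$. The minimal norm is $|\Lambda|:=\min\{\|\boldsymbol x\|:\boldsymbol 0\ne\boldsymbol x\in\Lambda\}$, and the set of minimal vectors is $S(\Lambda):=\{\boldsymbol x\in\Lambda:\|\boldsymbol x\|=|\Lambda|\}$.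 A collection $X=\{\boldsymbol x_1,\dots,\boldsymbol x_m\}$, $m\ge k$, of points on the unit sphere in $\mathbb R^k$ is eutactic if there are real numbers $c_1,\dots,c_m>0$ with $\|\boldsymbol y\|^2=\sum_{i=1}^m c_i\langle\boldsymbol y,\boldsymbol x_i\rangle^2$ for every $\boldsymbol y\in\mathbb R^k$. It is perfect if the matrices $\boldsymbol x_1\boldsymbol x_1^\top,\dots,\boldsymbol x_m\boldsymbol x_m^\top$ span the real vector space of all real symmetric $k\times k$ matrices. A lattice is perfect (respectively eutactic) if its set of minimal vectors (scaled to unit length) is perfect (respectively eutactic). A full-rank lattice in $\mathbb R^k$ is extreme if it is a local maximum of the (lattice sphere) packing density function in dimension $k$. *)

(* Defs.v *)
From HB Require Import structures.
From mathcomp Require Import all_boot all_order all_algebra.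
From mathcomp Require Import all_classical all_reals all_analysis.

Set Implicit Arguments.
Unset Strict Implicit.
Unset Printing Implicit Defensive.

Import Order.TTheory GRing.Theory Num.Theory.
Import numFieldNormedType.Exports.

Local Open Scope classical_set_scope.
Local Open Scope ring_scope.

Section Euclidean.
Context {R : realType} {k : nat}.
Implicit Types x y : 'rV[R]_k.

Definition dot x y : R := \sum_(i < k) x 0 i * y 0 i.

(* The norm that the library puts on ['rV[R]_k] is the sup norm; it induces
   the same topology as this Euclidean norm. *)
Definition enorm x : R := Num.sqrt (dot x x).

End Euclidean.

Section Frames.
Context {R : realType} {k n : nat}.
Implicit Types (F : n.-tuple 'rV[R]_k) (c : R).

Definition tight_frame F : Prop :=
  [/\ (k < n)%N,
      <<F>>%VS = fullv &
      exists2 gamma : R, 0 < gamma &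
        forall x : 'rV[R]_k,
          enorm x ^+ 2 = gamma * \sum_(i < n) dot (tnth F i) x ^+ 2].

Definition unit_ETF c F : Prop :=
  [/\ 0 < c < 1,
      tight_frame F,
      forall i : 'I_n, enorm (tnth F i) = 1 &
      forall i j : 'I_n, i != j -> `|dot (tnth F i) (tnth F j)| = c].

Definition maximal_unit_ETF c F : Prop :=
  unit_ETF c F /\ n = ((k * k.+1) %/ 2)%N.

Definition int_span F : set 'rV[R]_k := [set x | inIntSpan F x].

End Frames.

Section Lattices.
Context {R : realType} {k : nat}.
Implicit Types L : set 'rV[R]_k.

Definition is_lattice L : Prop := zmod_closed [in L] /\ L `<=` isolated L.

(* For a nonzero lattice the infimum is attained, hence a minimum. *)
Definition min_norm L : R :=
  inf [set enorm x | x in [set x | L x /\ x != 0]].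

Definition min_vectors L : set 'rV[R]_k :=
  [set x | L x /\ enorm x = min_norm L].

Definition unit_min_vectors L : set 'rV[R]_k :=
  [set (min_norm L)^-1 *: x | x in min_vectors L].

(* A duplicate-free sequence stands for a finite collection of points. *)
Definition spherical (X : seq 'rV[R]_k) : Prop :=
  [/\ uniq X, (k <= size X)%N & forall x, x \in X -> enorm x = 1].

Definition eutactic (X : seq 'rV[R]_k) : Prop :=
  exists2 c : 'rV[R]_k -> R,
    forall x, x \in X -> 0 < c x &
    forall y : 'rV[R]_k, enorm y ^+ 2 = \sum_(x <- X) c x * dot y x ^+ 2.

(* Points are row vectors, so [x^T *m x] is the rank-one symmetric matrix
   usually written x x^T for column vectors. *)
Definition perfect (X : seq 'rV[R]_k) : Prop :=
  forall S : 'M[R]_k, (S \in <<[seq x^T *m x | x <- X]>>%VS) = (S^T == S).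

Definition perfect_lattice L : Prop :=
  is_lattice L /\
  exists X : seq 'rV[R]_k,
    [/\ [set` X] = unit_min_vectors L, spherical X & perfect X].

Definition eutactic_lattice L : Prop :=
  is_lattice L /\
  exists X : seq 'rV[R]_k,
    [/\ [set` X] = unit_min_vectors L, spherical X & eutactic X].

Definition full_rank L : Prop :=
  exists2 X : seq 'rV[R]_k, [set` X] `<=` L & <<X>>%VS = fullv.

Definition lattice_basis L (B : 'M[R]_k) : Prop :=
  B \in unitmx /\ L = int_span [tuple row i B | i < k].

(* The absolute determinant of a basis, which does not depend on the basis
   chosen ([0] if [L] has no basis). *)
Definition lattice_det L : R :=
  xget 0 [set `|\det B| | B in lattice_basis L].

End Lattices.

(* Lebesgue measure of a Borel subset of R^k, as an iterated integral over the
   coordinates; R^0 is a point of mass 1. *)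
Fixpoint volume {R : realType} (k : nat) : set 'rV[R]_k -> \bar R :=
  match k with
  | 0 => fun A => (\1_A (0 : 'rV[R]_0))%:E
  | k'.+1 => fun A =>
      (\int[lebesgue_measure]_t
         volume [set v : 'rV[R]_k' | A (row_mx (t%:M : 'rV[R]_1) v)])%E
  end.

Section Packing.
Context {R : realType} {k : nat}.
Implicit Types L : set 'rV[R]_k.

(* The largest non-overlapping balls centred at the points of [L] have radius
   [min_norm L / 2], and there is one of them per fundamental domain. *)
Definition packing_density L : R :=
  fine (volume [set x : 'rV[R]_k | enorm x <= min_norm L / 2]) / lattice_det L.

(* The space of full-rank lattices is the quotient of GL_k(R) by GL_k(Z), so
   the lattices near [L] are the images of [L] under the linear maps near the
   identity. *)
Definition extreme L : Prop :=
  [/\ is_lattice L,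
      full_rank L &
      \forall g \near (1%:M : 'M[R]_k), g \in unitmx ->
        packing_density [set x *m g | x in L] <= packing_density L].

End Packing.

(* Main.v *)
From HB Require Import structures.
Require Import Defs.
From mathcomp Require Import all_boot all_order all_algebra fingroup perm.
From mathcomp Require Import all_classical all_reals all_analysis.
From mathcomp Require Import measurable_realfun.
From mathcomp Require Import ring lra.
Import Order.TTheory GRing.Theory Num.Theory.
Import numFieldNormedType.Exports.
Local Open Scope classical_set_scope.
Local Open Scope ring_scope.
Set Implicit Arguments.
Unset Strict Implicit.
Unset Printing Implicit Defensive.

(** The rank-one matrices f^T f of an equiangular family of unit vectors have
    Gram matrix (1 - c^2) I + c^2 J for the trace form, which is invertible, so
    they are linearly independent ([equiangular_outer_free]).  A maximal frame
    has as many vectors as the space of symmetric k x k matrices has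
    dimensions, hence these matrices span it ([free_sym_span]).  The frame
    vectors have length 1, which is the minimal norm, so they are minimal
    vectors and the lattice is perfect.

    Tightness says that the identity is a positive combination of the f^T f.
    The lattice may have minimal vectors outside the frame; give all minimal
    vectors a small weight e > 0, express the sum of their rank-one matrices
    in the spanning matrices f^T f, and subtract e times that expression from
    the weights of the frame.  For e small all weights stay positive
    ([eutactic_superset]), so the lattice is eutactic.

    That it is extreme is the easy half of Voronoi's theorem, and only the
    frame vectors among the minimal vectors are needed for it.  Let S be a
    small symmetric matrix whose quadratic form is nonnegative on the frame,
    and let s be the sum of its values there.  By tightness tr S is a positive
    multiple of s; by perfection every entry of S is O(s); so
    det (1 + S) = 1 + tr S + O(s^2) is at least 1 ([det1D_sym_ge1]).  Applied to
    S = A / t - 1, where A = h h^T is the Gram matrix of a linear map h near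
    the identity and t bounds the form A from below on the frame, this gives
    t^k <= det A ([hermite_locally_maximal]), hence m^k <= |det h| for the
    minimal norm m of the image lattice.  Since the volume of a ball scales
    with the k-th power of its radius ([volume_ball_dilation]) and the lattice
    determinant is multiplied by |det h| ([lattice_det_mul]), the packing
    density of the image lattice is at most the original one. *)

(** * Euclidean norm and quadratic forms *)

Lemma dot_ge0 (R : realType) (k : nat) (x : 'rV[R]_k) : 0 <= dot x x.
Proof. by apply: sumr_ge0 => i _; rewrite -expr2 sqr_ge0. Qed.

Lemma dotC (R : realType) (k : nat) (x y : 'rV[R]_k) : dot x y = dot y x.
Proof. by apply: eq_bigr => i _; rewrite mulrC. Qed.

Lemma enormK (R : realType) (k : nat) (x : 'rV[R]_k) : enorm x ^+ 2 = dot x x.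
Proof. by rewrite sqr_sqrtr// dot_ge0. Qed.

Lemma entry_le_enorm (R : realType) (k : nat) (x : 'rV[R]_k) (i : 'I_k) :
  `|x 0 i| <= enorm x.
Proof.
rewrite -(ler_pXn2r (n := 2))// ?nnegrE ?sqrtr_ge0// enormK real_normK ?num_real//.
rewrite /dot (bigD1 i)//= expr2 lerDl; apply: sumr_ge0 => j _.
by rewrite -expr2 sqr_ge0.
Qed.

Lemma enorm1_neq0 (R : realType) (k : nat) (x : 'rV[R]_k) :
  enorm x = 1 -> x != 0.
Proof.
apply: contra_eq_neq => ->; rewrite /enorm /dot big1 ?sqrtr0 1?eq_sym ?oner_eq0//.
by move=> i _; rewrite mxE mul0r.
Qed.

Lemma mulmx_unit_neq0 (R : realType) (k : nat) (x : 'rV[R]_k) (h : 'M[R]_k) :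
  h \in unitmx -> x != 0 -> x *m h != 0.
Proof. by move=> hU; apply: contra_neq => xh; rewrite -(mulmxK hU x) xh mul0mx. Qed.

Local Notation outer x := (x^T *m x).

Definition quad (R : realType) (k : nat) (x : 'rV[R]_k) (S : 'M[R]_k) : R :=
  (x *m S *m x^T) 0 0.

Lemma mulmx_tr_dot (R : realType) (k : nat) (x y : 'rV[R]_k) :
  (x *m y^T) 0 0 = dot x y.
Proof. by rewrite mxE; apply: eq_bigr => i _; rewrite mxE. Qed.

Lemma quad_outer (R : realType) (k : nat) (x y : 'rV[R]_k) :
  quad x (outer y) = dot x y ^+ 2.
Proof.
rewrite /quad mulmxA -[_ *m y *m _]mulmxA mxE big_ord1.
by rewrite !mulmx_tr_dot (dotC y x).
Qed.

Lemma quad1 (R : realType) (k : nat) (x : 'rV[R]_k) : quad x 1%:M = dot x x.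
Proof. by rewrite /quad mulmx1 mulmx_tr_dot. Qed.

Lemma quad_is_linear (R : realType) (k : nat) (x : 'rV[R]_k) :
  linear (quad x).
Proof. by move=> a S T; rewrite /quad mulmxDr mulmxDl -scalemxAr -scalemxAl !mxE. Qed.

HB.instance Definition _ (R : realType) (k : nat) (x : 'rV[R]_k) :=
  GRing.isLinear.Build R 'M[R]_k R *%R (quad x) (quad_is_linear x).

Lemma outer_sym (R : realType) (k : nat) (x : 'rV[R]_k) :
  (outer x)^T = outer x.
Proof. by rewrite trmx_mul trmxK. Qed.

Lemma mxtrace_outer (R : realType) (k : nat) (x : 'rV[R]_k) (S : 'M[R]_k) :
  \tr (outer x *m S) = quad x S.
Proof. by rewrite mxtrace_mulC mulmxA mxtrace_mulC mulmxA /quad /mxtrace big_ord1. Qed.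

Lemma quad_bound (R : realType) (k : nat) (x : 'rV[R]_k) (S : 'M[R]_k) (e : R) :
  enorm x = 1 -> (forall i j, `|S i j| <= e) -> `|quad x S| <= k%:R ^+ 2 * e.
Proof.
move=> x1 Se.
have xi i : `|x 0 i| <= 1 by rewrite -x1 entry_le_enorm.
rewrite /quad mxE (le_trans (ler_norm_sum _ _ _))//.
rewrite expr2 -mulrA [leRHS]mulr_natl -[X in _ <= _ *+ X]card_ord -sumr_const.
apply: ler_sum => j _; have -> : x^T j 0 = x 0 j by rewrite mxE.
rewrite normrM.
rewrite -[leRHS]mulr1 ler_pM// mxE (le_trans (ler_norm_sum _ _ _))//.
rewrite mulr_natl -[X in _ <= _ *+ X]card_ord -sumr_const.
by apply: ler_sum => i _; rewrite normrM -[leRHS]mul1r ler_pM.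
Qed.

(** Polarization: a symmetric bilinear form vanishes with its quadratic form. *)
Lemma quad_eq0 (R : realType) (k : nat) (S : 'M[R]_k) : S^T = S ->
  (forall x, quad x S = 0) -> S = 0.
Proof.
move=> Ssym S0; apply/matrixP => i j; rewrite mxE.
pose b (x y : 'rV[R]_k) := (x *m S *m y^T) 0 0.
have bC x y : b x y = b y x.
  have E : (x *m S *m y^T)^T = y *m S *m x^T.
    by rewrite !trmx_mul trmxK Ssym mulmxA.
  by rewrite /b -E [RHS]mxE.
have bE : b (delta_mx 0 i) (delta_mx 0 j) = S i j.
  by rewrite /b -rowE trmx_delta -colE !mxE.
have bD x y z : b (x + y) z = b x z + b y z.
  by rewrite /b !mulmxDl [LHS]mxE.
have b0 x : b x x = 0 := S0 x.
have := b0 (delta_mx 0 i + delta_mx 0 j).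
rewrite bD ![b _ (_ + _)]bC !bD !b0 [b (delta_mx 0 j) _]bC bE; lra.
Qed.

(** * Rank-one matrices and the space of symmetric matrices *)

Lemma sum_succ_ord (k : nat) : (\sum_(i < k) i.+1 = (k * k.+1) %/ 2)%N.
Proof.
rewrite -(big_mkord xpredT (fun i => i.+1)) -[LHS]add0n.
by rewrite -(big_nat_recl k 0 id)// bin2_sum bin2 /= divn2 mulnC.
Qed.

(** The matrices E_ij + E_ji with j <= i span the symmetric matrices. *)
Lemma dim_sym_le (R : realType) (k : nat) :
  exists2 V : {vspace 'M[R]_k}, (\dim V <= (k * k.+1) %/ 2)%N &
    forall S : 'M[R]_k, S^T = S -> S \in V.
Proof.
pose P := [pred p : 'I_k * 'I_k | (p.2 <= p.1)%N].
pose d (p : 'I_k * 'I_k) : 'M[R]_k := delta_mx p.1 p.2 + delta_mx p.2 p.1.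
exists <<[seq d p | p <- enum P]>>%VS.
  apply: (leq_trans (dim_span _)); rewrite size_map -cardE -sum1_card.
  rewrite -(pair_big_dep xpredT (fun i j : 'I_k => (j <= i)%N) (fun _ _ => 1%N)) /=.
  rewrite -sum_succ_ord leq_sum// => i _.
  rewrite -(big_ord_widen k (fun=> 1%N) (ltn_ord i)).
  by rewrite sum1_card card_ord.
move=> S Ssym.
have -> : S = \sum_i \sum_j (S i j / 2) *: d (i, j).
  rewrite {1}[S](_ : _ = 2^-1 *: (S + S^T)); last first.
    by rewrite Ssym scalerDr -scalerDl (_ : 2^-1 + 2^-1 = 1) ?scale1r//; lra.
  rewrite {1}[S]matrix_sum_delta [S in S^T]matrix_sum_delta.
  rewrite linear_sum -big_split scaler_sumr; apply: eq_bigr => i _ /=.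
  rewrite linear_sum -big_split scaler_sumr; apply: eq_bigr => j _ /=.
  by rewrite linearZ /= trmx_delta -scalerDr scalerA mulrC.
apply: rpred_sum => i _; apply: rpred_sum => j _; apply: rpredZ.
have [ji|ij] := leqP j i.
  by apply/memv_span/mapP; exists (i, j) => //; rewrite mem_enum.
rewrite (_ : d (i, j) = d (j, i)); last by rewrite /d addrC.
by apply/memv_span/mapP; exists (j, i) => //; rewrite mem_enum; apply: ltnW.
Qed.

(** Pairing a linear relation with each f_j^T f_j for the trace form gives
    (1 - c^2) a_j + c^2 s = 0, where s is the sum of the coefficients; summing
    over j forces s = 0, and then every a_j = 0. *)
Lemma equiangular_outer_free (R : realType) (k n : nat) (c : R)
    (F : n.-tuple 'rV[R]_k) : 0 < c < 1 ->
  (forall i, enorm (tnth F i) = 1) ->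
  (forall i j, i != j -> `|dot (tnth F i) (tnth F j)| = c) ->
  free [tuple outer (tnth F i) | i < n].
Proof.
move=> /andP[c0 c1] F1 Fc; apply/freeP => a a0.
have {}a0 : \sum_i a i *: outer (tnth F i) = 0.
  by rewrite -[RHS]a0; apply: eq_bigr => i _; rewrite -tnth_nth tnth_mktuple.
have E j : (1 - c ^+ 2) * a j + c ^+ 2 * \sum_i a i = 0.
  have := congr1 (quad (tnth F j)) a0.
  rewrite /= linear_sum linear0 => H; rewrite -[RHS]H /=.
  under [RHS]eq_bigr => i _ do rewrite linearZ /= quad_outer.
  rewrite [RHS](bigD1 j)//= -enormK F1 !expr1n.
  have -> : \sum_(i | i != j) a i * dot (tnth F j) (tnth F i) ^+ 2
      = c ^+ 2 * \sum_(i | i != j) a i.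
    rewrite mulr_sumr; apply: eq_bigr => i ij.
    by rewrite -real_normK ?num_real// Fc 1?eq_sym// mulrC.
  rewrite [in LHS](bigD1 j)//=; ring.
have c2 : c ^+ 2 < 1 by rewrite expr_lt1// ltW.
have s0 : \sum_i a i = 0.
  have : \sum_j ((1 - c ^+ 2) * a j + c ^+ 2 * \sum_i a i) = 0.
    by apply: big1 => j _; exact: E.
  rewrite big_split /= -mulr_sumr sumr_const card_ord -mulr_natl mulrA -mulrDl.
  move/eqP; rewrite mulf_eq0 => /orP[|/eqP//]; rewrite gt_eqF//.
  rewrite ltr_pwDl ?subr_gt0// mulr_ge0// sqr_ge0//.
move=> j; have := E j; rewrite s0 mulr0 addr0 => /eqP.
by rewrite mulf_eq0 subr_eq0 gt_eqF//= => /eqP.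
Qed.

(** A free family of symmetric matrices as large as the dimension bound of
    [dim_sym_le] has no room left outside its span. *)
Lemma free_sym_span (R : realType) (k n : nat) (X : n.-tuple 'M[R]_k) :
  free X -> {in X, forall S, S^T = S} -> n = ((k * k.+1) %/ 2)%N ->
  forall S : 'M[R]_k, S^T = S -> S \in <<X>>%VS.
Proof.
move=> Xf Xs nE S Ss; have [V dV sV] := @dim_sym_le R k.
have XV : (<<X>> <= V)%VS by apply/span_subvP => T TX; apply/sV/Xs.
suff -> : <<X>>%VS = V by exact: sV.
by apply/eqP; rewrite eqEdim XV /= (eqP Xf) size_tuple nE.
Qed.

Lemma span_outer_sym (R : realType) (k : nat) (X : seq 'rV[R]_k) (S : 'M[R]_k) :
  S \in <<[seq outer x | x <- X]>>%VS -> S^T = S.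
Proof.
move=> /(@coord_span _ _ _ (in_tuple _)) ->.
rewrite linear_sum; apply: eq_bigr => i _; rewrite linearZ /=; congr (_ *: _).
have /mapP[x _ ->] : [seq outer x | x <- X]`_i \in [seq outer x | x <- X].
  by rewrite mem_nth.
exact: outer_sym.
Qed.

(** The tight frame identity equates two quadratic forms, hence their matrices. *)
Lemma tight_sum_outer (R : realType) (k n : nat) (F : n.-tuple 'rV[R]_k) (g : R) :
  (forall x : 'rV[R]_k, enorm x ^+ 2 = g * \sum_i dot (tnth F i) x ^+ 2) ->
  g *: \sum_i outer (tnth F i) = 1%:M.
Proof.
move=> H; apply/esym/eqP; rewrite -subr_eq0; apply/eqP/quad_eq0.
  rewrite linearB linearZ /= linear_sum /= trmx1; congr (_ - _ *: _).
  by apply: eq_bigr => i _; exact: outer_sym.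
move=> x; rewrite linearB linearZ /= linear_sum /= quad1 -enormK H.
apply/eqP; rewrite subr_eq0; apply/eqP; congr (_ * _).
by apply: eq_bigr => i _; rewrite quad_outer dotC.
Qed.

(** * Perfection and eutaxy of sets containing the frame *)

Lemma perfect_superset (R : realType) (k n : nat) (F : n.-tuple 'rV[R]_k)
    (X : seq 'rV[R]_k) :
  (forall S : 'M[R]_k, S^T = S -> S \in <<[tuple outer (tnth F i) | i < n]>>%VS) ->
  (forall i, tnth F i \in X) -> perfect X.
Proof.
move=> Fspan FX S; apply/idP/eqP => [|/Fspan]; first exact: span_outer_sym.
apply: subvP; apply: sub_span => _ /tnthP[i ->]; rewrite tnth_mktuple.
by apply/mapP; exists (tnth F i).
Qed.

(** Write the sum of the x^T x over X as a combination, with coefficients b_i, of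
    the f_i^T f_i.  Then the identity is e times this sum plus the f_i^T f_i
    weighted by g - e b_i, and these weights are nonnegative once e is small. *)
Lemma eutactic_superset (R : realType) (k n : nat) (F : n.-tuple 'rV[R]_k)
    (X : seq 'rV[R]_k) (g : R) : 0 < g ->
  (forall x : 'rV[R]_k, enorm x ^+ 2 = g * \sum_(i < n) dot (tnth F i) x ^+ 2) ->
  (forall S : 'M[R]_k, S^T = S -> S \in <<[tuple outer (tnth F i) | i < n]>>%VS) ->
  uniq X -> (forall i, tnth F i \in X) -> eutactic X.
Proof.
move=> g0 tight Fspan Xu FX.
have [b bE] : exists b : 'I_n -> R,
    \sum_(x <- X) outer x = \sum_i b i *: outer (tnth F i).
  have /Fspan/coord_span -> : (\sum_(x <- X) outer x)^T = \sum_(x <- X) outer x.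
    by rewrite linear_sum; apply: eq_bigr => x _; exact: outer_sym.
  eexists; apply: eq_bigr => i _; rewrite -tnth_nth tnth_mktuple; reflexivity.
pose B := 1 + \sum_i `|b i|.
have B0 : 0 < B by rewrite ltr_pwDl// sumr_ge0.
pose e := g / B.
have e0 : 0 < e by rewrite divr_gt0.
have eb i : 0 <= g - e * b i.
  rewrite subr_ge0 /e mulrAC ler_pdivrMr// ler_wpM2l ?(ltW g0)//.
  rewrite (le_trans (ler_norm _))// /B (bigD1 i)//= addrCA lerDl addr_ge0//.
  exact: sumr_ge0.
exists (fun x => e + \sum_(i | tnth F i == x) (g - e * b i)) => [x _|y].
  by rewrite ltr_wpDr// sumr_ge0.
have Xsum : \sum_(x <- X) dot y x ^+ 2 = \sum_i b i * dot y (tnth F i) ^+ 2.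
  have := congr1 (quad y) bE; rewrite !linear_sum /=.
  under eq_bigr do rewrite quad_outer.
  by move=> ->; apply: eq_bigr => i _; rewrite linearZ /= quad_outer.
under eq_bigr do rewrite mulrDl mulr_suml.
rewrite big_split /= -mulr_sumr Xsum tight.
rewrite (exchange_big_dep xpredT)//=.
have -> : \sum_i \sum_(x <- X | tnth F i == x) (g - e * b i) * dot y x ^+ 2
    = \sum_i (g - e * b i) * dot y (tnth F i) ^+ 2.
  apply: eq_bigr => i _; rewrite big_mkcond (bigD1_seq (tnth F i))//= eqxx.
  rewrite big1 ?addr0// => x xi.
  by rewrite eq_sym (negPf xi).
rewrite !mulr_sumr -big_split /=; apply: eq_bigr => i _.
rewrite (dotC (tnth F i)); ring.
Qed.

(** * Determinants near the identity *)

(** The quadratic remainder of a product of factors 1 + x_i.  The induction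
    multiplies 1 + s + r, with r the previous remainder, by 1 + y. *)
Lemma prod1D_bound (R : realType) (n : nat) : exists2 C : R, 0 <= C &
  forall (x : 'I_n -> R) (e : R), e <= 1 -> (forall i, `|x i| <= e) ->
  `|\prod_i (1 + x i) - 1 - \sum_i x i| <= C * e ^+ 2.
Proof.
elim: n => [|n [C C0 IH]].
  exists 0 => // x e _ _; rewrite !big_ord0 subrr subr0 normr0 mul0r//.
exists (2 * C + n%:R); first by rewrite addr_ge0// mulr_ge0.
move=> x e e1 xe.
rewrite !big_ord_recr /=; set y := x ord_max.
pose x' (i : 'I_n) := x (widen_ord (leqnSn n) i).
have := IH x' e e1 (fun i => xe _).
rewrite -/(\prod_i (1 + x' i)) -/(\sum_i x' i).
set P := \prod_i _; set s := \sum_i _ => Pr.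
have sE : `|s| <= n%:R * e.
  rewrite (le_trans (ler_norm_sum _ _ _))//.
  rewrite (le_trans (ler_sum _ (fun i _ => xe _)))// sumr_const card_ord.
  by rewrite mulr_natl.
have ye : `|y| <= e := xe _.
have e0 : 0 <= e := le_trans (normr_ge0 _) ye.
rewrite [X in `|X|](_ : _ = y * s + (P - 1 - s) + y * (P - 1 - s)); last by ring.
rewrite (le_trans (ler_normD _ _))// (le_trans (lerD (ler_normD _ _) (lexx _)))//.
rewrite !normrM.
have h1 : `|y| * `|s| <= e * (n%:R * e) by rewrite ler_pM.
have h2 : `|y| * `|P - 1 - s| <= 1 * (C * e ^+ 2) by rewrite ler_pM// (le_trans ye).
nra.
Qed.

(** A nontrivial permutation moves some i and also its image, so its product in the
    Leibniz formula contains two off-diagonal factors of size e; the other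
    factors are at most 2. *)
Lemma prod_offdiag_bound (R : realType) (k : nat) (E : 'M[R]_k) (e : R)
    (s : 'S_k) : e <= 1 -> (forall i j, `|E i j| <= e) -> s != 1%g ->
  `|\prod_i (1%:M + E) i (s i)| <= 2 ^+ k * e ^+ 2.
Proof.
move=> e1 Ee s1.
have [i si] : exists i, s i != i.
  apply/existsP; rewrite -negb_forall; apply: contra s1 => /forallP H.
  by apply/eqP/permP => i; rewrite perm1; apply/eqP.
have ssi : s (s i) != s i by rewrite (inj_eq perm_inj).
have e0 : 0 <= e := le_trans (normr_ge0 _) (Ee i i).
rewrite normr_prod.
(* A bound of the j-th factor, written so that its product over [j] splits. *)
pose b j : R := 2 * ((if j == i then e else 1) * (if j == s i then e else 1)).
have -> : 2 ^+ k * e ^+ 2 = \prod_(j < k) b j.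
  rewrite big_split /= prodr_const card_ord; congr (_ * _).
  by rewrite big_split /= -!big_mkcond !big_pred1_eq expr2.
apply: ler_prod => j _; rewrite normr_ge0 /= /b !mxE.
have isi : (i == s i) = false by rewrite eq_sym (negPf si).
have sisi : (s i == s (s i)) = false by rewrite eq_sym (negPf ssi).
have [->|ji] := eqVneq j i.
  rewrite isi /= mulr1 add0r (le_trans (Ee _ _))//; lra.
have [->|jsi] := eqVneq j (s i).
  rewrite sisi /= mul1r add0r (le_trans (Ee _ _))//; lra.
rewrite !mulr1 (le_trans (ler_normD _ _))//.
have := Ee j (s j); case: (_ == _) => /=; rewrite ?normr1 ?normr0; lra.
Qed.

(** In the Leibniz formula the trivial permutation contributes 1 + tr E up to
    second order, and every other permutation a term of second order. *)
Lemma det1D_ge (R : realType) (k : nat) : exists2 C : R, 0 <= C &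
  forall (E : 'M[R]_k) (e : R), e <= 1 -> (forall i j, `|E i j| <= e) ->
  1 + \tr E - C * e ^+ 2 <= \det (1%:M + E).
Proof.
have [C C0 HC] := prod1D_bound R k.
pose K : R := #|[pred s : 'S_k | s != 1%g]|%:R * 2 ^+ k.
exists (C + K); first by rewrite addr_ge0// mulr_ge0// exprn_ge0.
move=> E e e1 Ee.
rewrite /determinant (bigD1 1%g)//= odd_perm1 expr0 mul1r.
have D : `|\prod_i (1 + E i i) - 1 - \tr E| <= C * e ^+ 2 by apply: HC.
rewrite (eq_bigr (fun i => 1 + E i i)); last first.
  by move=> i _; rewrite perm1 !mxE eqxx.
set P := \prod_i _ in D *; set Q := \sum_(s | _) _.
have QK : `|Q| <= K * e ^+ 2.
  rewrite (le_trans (ler_norm_sum _ _ _))// /K -mulrA mulr_natl -sumr_const.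
  apply: ler_sum => s s1; rewrite normrMsign; exact: prod_offdiag_bound.
move: D QK; rewrite !ler_norml => /andP[h _] /andP[h' _]; lra.
Qed.

(** The heart of Voronoi's theorem.  Since the f_i^T f_i span the symmetric
    matrices, each entry of S is a fixed combination of the values of its
    quadratic form at the f_i; these are nonnegative, so with sg their sum each
    entry is O(sg), while tr S = g * sg by tightness.  In
    det (1 + S) >= 1 + tr S - O(sg^2) the linear term wins for small S. *)
Lemma det1D_sym_ge1 (R : realType) (k n : nat) (F : n.-tuple 'rV[R]_k) (g : R) :
  0 < g -> g *: \sum_i outer (tnth F i) = 1%:M ->
  (forall S : 'M[R]_k, S^T = S -> S \in <<[tuple outer (tnth F i) | i < n]>>%VS) ->
  exists2 d : R, 0 < d & forall S : 'M[R]_k, S^T = S ->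
    (forall i j, `|S i j| <= d) -> (forall i, 0 <= quad (tnth F i) S) ->
    1 <= \det (1%:M + S).
Proof.
move=> g0 Fg Fspan.
have [C C0 HC] := det1D_ge R k.
have H (p : 'I_k * 'I_k) : exists l : 'I_n -> R,
    delta_mx p.1 p.2 + delta_mx p.2 p.1 = \sum_i l i *: outer (tnth F i).
  have /Fspan/coord_span -> : (delta_mx p.1 p.2 + delta_mx p.2 p.1 : 'M[R]_k)^T
      = delta_mx p.1 p.2 + delta_mx p.2 p.1.
    by rewrite linearD /= !trmx_delta addrC.
  eexists; apply: eq_bigr => i _; rewrite -tnth_nth tnth_mktuple; reflexivity.
have [l lE] := choice H.
pose L := \sum_p \sum_i `|l p i|.
have L0 : 0 <= L by apply: sumr_ge0 => p _; apply: sumr_ge0.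
have entry (S : 'M[R]_k) : S^T = S -> (forall i, 0 <= quad (tnth F i) S) ->
    forall a b, `|S a b| <= L * \sum_i quad (tnth F i) S.
  move=> Ss Sp a b.
  have /(congr1 (fun T => \tr (T *m S))) := lE (a, b).
  rewrite /= mulmxDl mxtraceD.
  have tr_delta u v : \tr (delta_mx u v *m S) = S v u.
    rewrite /mxtrace (bigD1 u)//= big1 ?addr0; last first.
      by move=> w wu; rewrite !mxE big1// => z _; rewrite !mxE (negPf wu) mul0r.
    rewrite mxE (bigD1 v)//= big1 ?addr0; first by rewrite mxE !eqxx mul1r.
    by move=> z zv; rewrite !mxE (negPf zv) andbF mul0r.
  rewrite !tr_delta -{1}Ss mxE mulmx_suml raddf_sum /= => E.
  have {}E : 2 * S a b = \sum_i l (a, b) i * quad (tnth F i) S.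
    rewrite mulr_natl mulr2n E; apply: eq_bigr => i _.
    by rewrite -scalemxAl mxtraceZ mxtrace_outer.
  set sg := \sum_i quad _ _.
  have sg0 : 0 <= sg by apply: sumr_ge0.
  have : `|2 * S a b| <= L * sg.
    rewrite E (le_trans (ler_norm_sum _ _ _))// /L (bigD1 (a, b))//= mulrDl.
    rewrite ler_wpDr ?mulr_ge0//.
      by apply: sumr_ge0 => p _; apply: sumr_ge0.
    rewrite mulr_suml; apply: ler_sum => i _; rewrite normrM ler_wpM2l//.
    rewrite ger0_norm// /sg (bigD1 i)//= ler_wpDr//; exact: sumr_ge0.
  rewrite normrM ger0_norm// => h; have := normr_ge0 (S a b); lra.
have trE (S : 'M[R]_k) : \tr S = g * \sum_i quad (tnth F i) S.
  rewrite -{1}[S]mul1mx -Fg -scalemxAl mxtraceZ mulmx_suml raddf_sum /=.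
  by congr (_ * _); apply: eq_bigr => i _; rewrite mxtrace_outer.
(* [M] is chosen so that [sg * M <= 1] yields both [L * sg <= 1], needed to
   expand the determinant, and [C * (L * sg) ^+ 2 <= g * sg]. *)
pose M := 1 + L + C * L ^+ 2 / g.
have M0 : 0 < M.
  by rewrite ltr_wpDr ?ltr_wpDr// divr_ge0 ?(ltW g0)// mulr_ge0// sqr_ge0.
exists (g / (k.+1%:R * M)); first by rewrite divr_gt0// mulr_gt0.
move=> S Ss Sd Sp.
set sg := \sum_i quad (tnth F i) S.
have sg0 : 0 <= sg by apply: sumr_ge0.
have sM : sg * M <= 1.
  have : \tr S <= k%:R * (g / (k.+1%:R * M)).
    rewrite -[k in k%:R]card_ord mulr_natl -sumr_const.
    by apply: ler_sum => i _; rewrite (le_trans (ler_norm _)).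
  rewrite trE -/sg.
  have -> : k%:R * (g / (k.+1%:R * M)) = g * ((k%:R / k.+1%:R) / M).
    by field; rewrite gt_eqF//=.
  rewrite ler_pM2l// ler_pdivlMr// => /le_trans -> //.
  by rewrite ler_pdivrMr// mul1r ler_nat.
have LM : L * sg <= 1.
  rewrite (le_trans _ sM)// mulrC ler_wpM2l//.
  rewrite /M addrAC ler_wpDl// addr_ge0// divr_ge0 ?(ltW g0)// mulr_ge0// sqr_ge0//.
apply: le_trans (HC S _ LM (entry S Ss Sp)).
rewrite trE -/sg -addrA lerDl exprMn.
have h : C * L ^+ 2 * sg <= g.
  have h : sg * (C * L ^+ 2 / g) <= 1.
    rewrite (le_trans _ sM)// ler_wpM2l// /M ler_wpDl// addr_ge0//.
  by move: h; rewrite mulrA ler_pdivrMr// mul1r mulrC.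
have {}h : C * L * L * sg <= g by rewrite -(mulrA C) -expr2.
by rewrite subr_ge0 [sg ^+ 2]expr2 !mulrA ler_wpM2r.
Qed.

(** Among positive definite forms A, the ratio of the k-th power of the minimum
    of A over the frame to det A is locally maximal at the identity form. *)
Lemma hermite_locally_maximal (R : realType) (k n : nat) (F : n.-tuple 'rV[R]_k) (g : R) :
  0 < g -> g *: \sum_i outer (tnth F i) = 1%:M ->
  (forall S : 'M[R]_k, S^T = S -> S \in <<[tuple outer (tnth F i) | i < n]>>%VS) ->
  (forall i, enorm (tnth F i) = 1) -> (0 < n)%N ->
  exists2 d : R, 0 < d & forall (A : 'M[R]_k) (m : R), A^T = A ->
    (forall i j, `|A i j - (i == j)%:R| <= d) ->
    0 <= m -> (forall i, m <= quad (tnth F i) A) -> m ^+ k <= \det A.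
Proof.
move=> g0 Fg Fspan F1 n0.
have [d d0 Hd] := det1D_sym_ge1 g0 Fg Fspan.
pose K : R := 2 * (1 + k%:R ^+ 2).
have K0 : 0 < K by rewrite mulr_gt0// ltr_pwDl// sqr_ge0.
pose e := Num.min 1 d / K.
have min0 : 0 < Num.min 1 d by rewrite lt_min ltr01.
have e0 : 0 < e by rewrite divr_gt0.
exists e => // A m As Ae m0 mA.
have eK : e * K = Num.min 1 d by rewrite /e divfK// gt_eqF.
have h1 : e * K <= 1 by rewrite eK ge_min lexx.
have h2 : e * K <= d by rewrite eK ge_min lexx orbT.
have qA i : `|quad (tnth F i) A - 1| <= k%:R ^+ 2 * e.
  have -> : quad (tnth F i) A - 1 = quad (tnth F i) (A - 1%:M).
    by rewrite linearB /= quad1 -enormK F1 expr1n.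
  by apply: quad_bound => // u v; have := Ae u v; rewrite !mxE.
set q := k%:R ^+ 2 * e in qA.
have q0 : 0 <= q by rewrite mulr_ge0 ?sqr_ge0// ltW.
have KE : e * K = 2 * (e + q) by rewrite /K /q; ring.
(* Raising [m] to [1 - q], which still bounds the form from below on the frame,
   keeps [t] close to 1, so that [A / t] is close to the identity. *)
pose t := Num.max m (1 - q).
have tA i : t <= quad (tnth F i) A.
  by rewrite ge_max mA /=; have := qA i; rewrite ler_norml => /andP[]; lra.
have t_ge : 1 - q <= t by rewrite le_max lexx orbT.
have t_le : t <= 1 + q.
  have := qA (Ordinal n0); have := tA (Ordinal n0).
  by rewrite ler_norml => ? /andP[]; lra.
have t0 : 0 < t by lra.
have mt : m <= t by rewrite le_max lexx.
apply: (@le_trans _ _ (t ^+ k)); first by rewrite lerXn2r// nnegrE// ltW.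
pose S := t^-1 *: A - 1%:M.
have : 1 <= \det (1%:M + S).
  apply: Hd.
  - by rewrite linearB linearZ /= As trmx1.
  - move=> i j; rewrite !mxE.
    have -> : t^-1 * A i j - (i == j)%:R
      = ((A i j - (i == j)%:R) + (1 - t) * (i == j)%:R) / t.
      by field; rewrite gt_eqF.
    rewrite normrM normfV (gtr0_norm t0) ler_pdivrMr//.
    rewrite (le_trans (ler_normD _ _))// normrM.
    have B : `|1 - t| * `|(i == j)%:R| <= q.
      rewrite -[leRHS]mulr1 ler_pM//; last by case: eqP; rewrite ?normr1 ?normr0.
      by rewrite ler_norml; lra.
    have := Ae i j; have : d / 2 <= d * t by rewrite ler_wpM2l ?(ltW d0)//; lra.
    by move: B h2; rewrite KE; lra.
  - move=> i; rewrite linearB linearZ /= quad1 -enormK F1 expr1n subr_ge0.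
    by rewrite mulrC ler_pdivlMr// mul1r.
rewrite /S addrC subrK detZ exprVn mulrC ler_pdivlMr ?exprn_gt0//.
by rewrite mul1r.
Qed.

(** With h = g - 1, the matrix g g^T - 1 is h + h^T + h h^T. *)
Lemma near1_gram_close (R : realType) (k : nat) (d : R) : 0 < d ->
  \forall g \near (1%:M : 'M[R]_k),
    forall i j, `|(g *m g^T) i j - (i == j)%:R| <= d.
Proof.
move=> d0.
pose e := Num.min 1 (d / (2 + k%:R)).
have k2 : 0 < 2 + k%:R :> R by rewrite ltr_pwDl.
have e0 : 0 < e by rewrite lt_min ltr01 divr_gt0.
have e1 : e <= 1 by rewrite ge_min lexx.
have ed : e * (2 + k%:R) <= d by rewrite -ler_pdivlMr// ge_min lexx orbT.
apply/nbhs_ballP; exists e => // g gb i j.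
pose h := g - 1%:M.
have he u v : `|h u v| <= e.
  rewrite /h !mxE distrC; apply: ltW; have := gb.2 u v.
  by rewrite /ball /= !mxE.
have -> : (g *m g^T) i j - (i == j)%:R = h i j + h j i + (h *m h^T) i j.
  have -> : g = h + 1%:M by rewrite subrK.
  rewrite linearD /= trmx1 mulmxDl !mulmxDr mulmx1 mul1mx mul1mx.
  clearbody h; rewrite !mxE -/(1%:M); ring.
have : `|(h *m h^T) i j| <= k%:R * e.
  rewrite mxE (le_trans (ler_norm_sum _ _ _))//.
  rewrite mulr_natl -[X in _ <= _ *+ X]card_ord -sumr_const.
  apply: ler_sum => u _; rewrite normrM -[leRHS]mulr1 ler_pM// mxE.
  by rewrite (le_trans (he _ _)).
have := he i j; have := he j i.
rewrite !ler_norml => /andP[? ?] /andP[? ?] /andP[? ?]; apply/andP; split; lra.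
Qed.

(** * Discreteness and minimal norm *)

Lemma min_norm_le (R : realType) (k : nat) (L : set 'rV[R]_k) (x : 'rV[R]_k) :
  L x -> x != 0 -> min_norm L <= enorm x.
Proof.
move=> Lx x0; apply: ge_inf; last by exists x.
by exists 0 => _ [y _ <-]; exact: sqrtr_ge0.
Qed.

(** If the coordinates differ by less than 1/(k+1), then the squared length of the
    difference is at most k/(k+1) < 1, the squared minimal norm. *)
Lemma lattice_close_eq (R : realType) (k : nat) (L : set 'rV[R]_k)
    (x y : 'rV[R]_k) : zmod_closed [in L] -> min_norm L = 1 -> L x -> L y ->
  (forall i, `|x 0 i - y 0 i| < k.+1%:R^-1) -> x = y.
Proof.
move=> [_ Lsub] L1 Lx Ly xy; apply/eqP; rewrite -subr_eq0; apply/negPn/negP => d0.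
have Ld : L (x - y) by have := Lsub x y (mem_set Lx) (mem_set Ly); rewrite inE.
have : 1 <= dot (x - y) (x - y).
  have h : 1 <= enorm (x - y) by rewrite -L1 min_norm_le.
  by rewrite -enormK exprn_ege1.
apply/negP; rewrite -ltNge.
apply: (@le_lt_trans _ _ (k%:R * k.+1%:R^-1)).
  rewrite mulr_natl -[X in _ <= _ *+ X]card_ord -sumr_const.
  apply: ler_sum => i _; rewrite !mxE -expr2 -real_normK ?num_real// expr2.
  rewrite -[leRHS]mulr1 ler_pM// ltW//.
  by rewrite (lt_le_trans (xy i))// invf_le1// ler1n.
by rewrite ltr_pdivrMr// mul1r ltr_nat.
Qed.

Lemma lattice_isolated (R : realType) (k : nat) (L : set 'rV[R]_k) :
  zmod_closed [in L] -> min_norm L = 1 -> is_lattice L.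
Proof.
move=> Lz L1; split=> // x Lx; split; first exact: mem_set.
have e0 : 0 < k.+1%:R^-1 :> R by rewrite invr_gt0.
exists (ball x k.+1%:R^-1); first exact: nbhsx_ballx.
apply/seteqP; split=> [y [xy Ly]|_ ->] /=; last by split; [exact: ballxx|].
by apply/esym/(lattice_close_eq Lz L1 Lx Ly) => i; exact: xy.2.
Qed.

(** By [lattice_close_eq], each cube of a grid of mesh 1/(k+1) on [-1, 1]^k contains
    at most one lattice vector. *)
Lemma finite_unit_vectors (R : realType) (k : nat) (L : set 'rV[R]_k) :
  zmod_closed [in L] -> min_norm L = 1 ->
  finite_set [set x | L x /\ enorm x = 1].
Proof.
move=> Lz L1; set A := [set x | _].
(* The coordinates of unit vectors lie in [-1, 1], so scaling x + 1 by k + 1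
   gives at most 2 (k + 1), and the truncation is not capped by [inord]. *)
pose cell (x : 'rV[R]_k) : {ffun 'I_k -> 'I_(2 * k.+1).+1} :=
  [ffun i => inord (Num.truncn ((x 0 i + 1) * k.+1%:R))].
rewrite -(eq_finite_set (inj_card_eq (f := cell) _)); first exact: finite_finset.
move=> x y /set_mem[Lx x1] /set_mem[Ly y1] cxy.
apply: (lattice_close_eq Lz L1 Lx Ly) => i.
have pos (z : 'rV[R]_k) : enorm z = 1 -> 0 <= (z 0 i + 1) * k.+1%:R.
  move=> z1; have := entry_le_enorm z i; rewrite z1 ler_norml => /andP[? _].
  by rewrite mulr_ge0//; lra.
have lt_cells (z : 'rV[R]_k) : enorm z = 1 ->
    (Num.truncn ((z 0 i + 1) * k.+1%:R)%R < (2 * k.+1).+1)%N.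
  move=> z1; rewrite ltnS -(ler_nat R).
  have /andP[h _] := truncn_itv (pos z z1); rewrite (le_trans h)// natrM ler_wpM2r//.
  by have := entry_le_enorm z i; rewrite z1 ler_norml => /andP[_ ?]; lra.
have := congr1 (fun f : {ffun 'I_k -> 'I_(2 * k.+1).+1} => val (f i)) cxy.
rewrite /= !ffunE !inordK ?lt_cells// => exy.
have /andP[] := truncn_itv (pos x x1); have /andP[] := truncn_itv (pos y y1).
rewrite exy -[X in _ < X]natr1 => h1 h2; rewrite -[X in _ < X]natr1 => h3 h4.
have k0 : 0 < k.+1%:R :> R by [].
rewrite -[ltRHS]mul1r ltr_pdivlMr// -[k.+1%:R in ltLHS]gtr0_norm// -normrM.
move: h1 h2 h3 h4; rewrite ltr_norml => *; apply/andP; split; lra.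
Qed.

Lemma int_span_closed (R : realType) (k n : nat) (F : n.-tuple 'rV[R]_k) :
  zmod_closed [in int_span F].
Proof.
split.
  rewrite inE; exists [ffun=> 0]; rewrite big1// => i _.
  by rewrite ffunE mulr0z.
move=> _ _ /set_mem[a ->] /set_mem[b ->]; rewrite inE; exists [ffun i => a i - b i].
by rewrite -sumrB; apply: eq_bigr => i _; rewrite ffunE mulrzBr.
Qed.

Lemma mem_int_span (R : realType) (k n : nat) (F : n.-tuple 'rV[R]_k) (i : 'I_n) :
  int_span F (tnth F i).
Proof.
exists [ffun j => (j == i)%:Z]; rewrite (bigD1 i)//= ffunE eqxx mulr1z.
rewrite -tnth_nth big1 ?addr0// => j ji; by rewrite ffunE (negPf ji) mulr0z.
Qed.

(** The inverse of g is bounded, so an image x g cannot be much shorter than x. *)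
Lemma min_norm_mul_gt0 (R : realType) (k : nat) (L : set 'rV[R]_k) (g : 'M[R]_k) :
  g \in unitmx -> 0 < min_norm L -> (exists2 x, L x & x != 0) ->
  0 < min_norm [set x *m g | x in L].
Proof.
move=> gU L0 [x0 Lx0 x00].
pose M : R := 1 + \sum_j \sum_i `|invmx g i j|.
have M0 : 0 < M.
  by rewrite ltr_pwDl// sumr_ge0// => j _; rewrite sumr_ge0.
have bound (y : 'rV[R]_k) : dot (y *m invmx g) (y *m invmx g)
    <= k%:R * (enorm y * M) ^+ 2.
  rewrite /dot mulr_natl -[X in _ <= _ *+ X]card_ord -sumr_const.
  apply: ler_sum => j _; rewrite -expr2 -real_normK ?num_real//.
  rewrite ler_pXn2r ?nnegrE ?mulr_ge0 ?sqrtr_ge0 ?(ltW M0)//.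
  rewrite mxE (le_trans (ler_norm_sum _ _ _))//.
  rewrite (@le_trans _ _ (enorm y * \sum_i `|invmx g i j|))//.
    rewrite mulr_sumr; apply: ler_sum => i _.
    by rewrite normrM ler_wpM2r// entry_le_enorm.
  rewrite ler_wpM2l ?sqrtr_ge0// /M [in leRHS](bigD1 j)//= addrCA lerDl.
  by rewrite addr_ge0// sumr_ge0// => ? _; rewrite sumr_ge0.
pose N := k.+1%:R * M ^+ 2.
have N0 : 0 < N by rewrite mulr_gt0// exprn_gt0.
apply: (@lt_le_trans _ _ (Num.sqrt (min_norm L ^+ 2 / N))).
  by rewrite sqrtr_gt0 divr_gt0// exprn_gt0.
apply: lb_le_inf.
  exists (enorm (x0 *m g)), (x0 *m g) => //; split; first by exists x0.
  exact: mulmx_unit_neq0.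
move=> _ [y [[x Lx xy] y0] <-]; rewrite /enorm ler_wsqrtr// ler_pdivrMr//.
have x_neq0 : x != 0 by apply: contraNneq y0 => x0'; rewrite -xy x0' mul0mx.
have /le_trans -> // : min_norm L ^+ 2 <= dot x x.
  by rewrite -enormK ler_pXn2r ?nnegrE ?sqrtr_ge0 ?(ltW L0)// min_norm_le.
have := bound y; rewrite -xy mulmxK// => /le_trans -> //.
rewrite exprMn enormK mulrCA ler_wpM2l ?dot_ge0//.
by rewrite /N ler_wpM2r ?sqr_ge0// ler_nat.
Qed.

(** * Determinant of a lattice *)

Lemma mem_int_span_rows (R : realType) (k : nat) (B : 'M[R]_k) (x : 'rV[R]_k) :
  int_span [tuple row i B | i < k] x
  <-> exists a : 'rV[int]_k, x = map_mx intr a *m B.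
Proof.
have E (a : 'I_k -> int) : \sum_(i < k) [tuple row i B | i < k]`_i *~ a i
    = map_mx intr (\row_i a i) *m B.
  rewrite mulmx_sum_row; apply: eq_bigr => i _.
  by rewrite -tnth_nth tnth_mktuple !mxE scaler_int.
split=> [[a ->]|[a ->]]; first by exists (\row_i a i); rewrite -E.
exists [ffun i => a 0 i]; rewrite E; congr (map_mx _ _ *m _).
by apply/rowP => i; rewrite mxE ffunE.
Qed.

Lemma lattice_basis_mul (R : realType) (k : nat) (L : set 'rV[R]_k)
    (g B : 'M[R]_k) : g \in unitmx ->
  lattice_basis L B -> lattice_basis [set x *m g | x in L] (B *m g).
Proof.
move=> gU [BU LE]; split; first by rewrite unitmx_mul BU.
apply/seteqP; split=> [_ [x + <-]|x].
  rewrite LE => /mem_int_span_rows[a ->].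
  by apply/mem_int_span_rows; exists a; rewrite mulmxA.
move=> /mem_int_span_rows[a ->]; exists (map_mx intr a *m B).
  by rewrite LE; apply/mem_int_span_rows; exists a.
by rewrite mulmxA.
Qed.

Lemma lattice_basis_transition (R : realType) (k : nat) (L : set 'rV[R]_k)
    (B B' : 'M[R]_k) : lattice_basis L B -> lattice_basis L B' ->
  exists U : 'M[int]_k, B' = map_mx intr U *m B.
Proof.
move=> [_ LB] [_ LB'].
have H i : exists a : 'rV[int]_k, row i B' = map_mx intr a *m B.
  apply/mem_int_span_rows; rewrite -LB LB'; apply/mem_int_span_rows.
  by exists (delta_mx 0 i); rewrite map_delta_mx -rowE.
have [f fE] := choice H.
exists (\matrix_i f i); apply/row_matrixP => i.
by rewrite fE row_mul -map_row rowK.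
Qed.

(** The two transition matrices between the bases are integral with product of
    determinants 1, so their determinants are 1 or -1. *)
Lemma lattice_basis_det (R : realType) (k : nat) (L : set 'rV[R]_k)
    (B B' : 'M[R]_k) : lattice_basis L B -> lattice_basis L B' ->
  `|\det B| = `|\det B'|.
Proof.
move=> hB hB'.
have [U UE] := lattice_basis_transition hB hB'.
have [V VE] := lattice_basis_transition hB' hB.
have dB0 : \det B != 0 by move: (hB.1); rewrite unitmxE unitfE.
have uv : \det U * \det V = 1.
  apply/eqP; rewrite -(eqr_int R) intrM; apply/eqP/(mulIf dB0).
  rewrite mul1r [in RHS]VE UE !det_mulmx !det_map_mx; ring.
have U1 : `|\det U| = 1 :> int.
  have /eqP : (`|\det U| * `|\det V| = 1)%N by rewrite -abszM uv.
  by rewrite muln_eq1 => /andP[/eqP h _]; rewrite -abszE h.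
by rewrite UE det_mulmx det_map_mx normrM -intr_norm U1 mul1r.
Qed.

Lemma lattice_detE (R : realType) (k : nat) (L : set 'rV[R]_k) (B : 'M[R]_k) :
  lattice_basis L B -> lattice_det L = `|\det B|.
Proof.
move=> hB; rewrite /lattice_det.
have : [set `|\det B| | B in lattice_basis L] (xget 0 [set `|\det B| | B in lattice_basis L]).
  by apply: xgetPex; exists `|\det B|; exists B.
by move=> [C hC <-]; exact: lattice_basis_det hC hB.
Qed.

Lemma lattice_det_ge0 (R : realType) (k : nat) (L : set 'rV[R]_k) :
  0 <= lattice_det L.
Proof. by rewrite /lattice_det; case: xgetP => // _ -> [B _ <-]. Qed.

(** Multiplication by g is a bijection between the bases of the two lattices; if
    there are none, both sides are 0 by convention. *)
Lemma lattice_det_mul (R : realType) (k : nat) (L : set 'rV[R]_k)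
    (g : 'M[R]_k) : g \in unitmx ->
  lattice_det [set x *m g | x in L] = `|\det g| * lattice_det L.
Proof.
move=> gU; have [[B hB]|nB] := pselect (exists B, lattice_basis L B).
  rewrite (lattice_detE hB) (lattice_detE (lattice_basis_mul gU hB)).
  by rewrite det_mulmx normrM mulrC.
have nB' : ~ exists B, lattice_basis [set x *m g | x in L] B.
  move=> [B hB]; apply: nB; exists (B *m invmx g).
  have gU' : invmx g \in unitmx by rewrite unitmx_inv.
  have := lattice_basis_mul gU' hB.
  congr lattice_basis; apply/seteqP; split=> [_ [_ [x Lx <-] <-]|x Lx].
    by rewrite mulmxK.
  by exists (x *m g); [exists x|rewrite mulmxK].
rewrite /lattice_det !xgetPN ?mulr0// => _ [B hB _]; [apply: nB|apply: nB'];
  by exists B.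
Qed.

(** * Volume of balls *)

(** Balls are indexed by the square of the radius, because the slices of a ball
    at first coordinate t are then the balls of parameter s - t^2, empty for
    t^2 > s. *)
Definition sqball (R : realType) (k : nat) (s : R) : set 'rV[R]_k :=
  [set x | dot x x <= s].
Arguments sqball {R} k s.

Lemma dot_row_mx (R : realType) (k : nat) (t : R) (v : 'rV[R]_k) :
  dot (row_mx (t%:M : 'rV[R]_1) v) (row_mx (t%:M : 'rV[R]_1) v)
  = t ^+ 2 + dot v v.
Proof.
rewrite /dot (@big_split_ord _ _ _ 1 k) /= big_ord1; congr (_ + _).
  by rewrite !row_mxEl !mxE eqxx mulr1n expr2.
by apply: eq_bigr => i _; rewrite !row_mxEr.
Qed.

Lemma volume_sqballS (R : realType) (k : nat) (s : R) :
  volume (sqball k.+1 s)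
  = (\int[lebesgue_measure]_t volume (sqball k (s - t ^+ 2)))%E.
Proof.
rewrite /=; apply: eq_integral => t _; congr volume.
by apply/seteqP; split=> v; rewrite /sqball /= dot_row_mx lerBrDl.
Qed.

Lemma volume_ge0 (R : realType) (k : nat) (A : set 'rV[R]_k) :
  (0 <= volume A)%E.
Proof.
elim: k A => [|k IH] A /=; first by rewrite lee_fin.
by apply: integral_ge0.
Qed.

Lemma nondecreasing_emeasurable (R : realType) (f : R -> \bar R) :
  {homo f : x y / x <= y >-> (x <= y)%E} -> measurable_fun [set: R] f.
Proof.
move=> f_nd mT; apply: (measurability _ (ErealGenCInfty.measurableE R)) => //.
move=> _ [_ [r ->] <-].
apply: measurableI => //; apply: is_interval_measurable => s t/=.
rewrite !in_itv/= !andbT => fs ft u /andP[su ut].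
by rewrite in_itv/= andbT (le_trans fs)// f_nd.
Qed.

Lemma measurable_slice (R : realType) (s : R) (f : R -> \bar R) :
  {homo f : x y / x <= y >-> (x <= y)%E} ->
  measurable_fun [set: R] (fun t : R => f (s - t ^+ 2)).
Proof.
move=> f_nd; apply: (measurableT_comp (nondecreasing_emeasurable f_nd)).
by apply: measurable_funB => //; exact: measurable_funX.
Qed.

(** Monotonicity in s is proved by the induction that also provides, through
    [measurable_slice], the measurability of the integrands. *)
Lemma volume_sqball_homo (R : realType) (k : nat) :
  {homo (fun s : R => volume (sqball k s)) : s t / s <= t >-> (s <= t)%E}.
Proof.
elim: k => [|k IH] s t st.
  rewrite /= lee_fin !indicE ler_nat.
  case: (boolP (_ \in sqball _ s)) => // /set_mem; rewrite /sqball /= => s0.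
  by rewrite mem_set//= (le_trans s0).
rewrite !volume_sqballS; apply: ge0_le_integral => //.
- by move=> x _; apply: volume_ge0.
- exact: (measurable_slice _ IH).
- exact: (measurable_slice _ IH).
- by move=> x _; apply: IH; rewrite lerB.
Qed.

(** Change of variable: the image of Lebesgue measure under division by a is a
    times Lebesgue measure. *)
Lemma ge0_integral_dilation (R : realType) (a : R) (f : R -> \bar R) :
  0 < a -> measurable_fun [set: R] f -> (forall t, 0 <= f t)%E ->
  (\int[lebesgue_measure]_t f (t / a)%R
   = a%:E * \int[lebesgue_measure]_t f t)%E.
Proof.
move=> a0 mf f0.
pose phi : R -> R := fun t => t / a.
have mphi : @measurable_fun _ _ (measurableTypeR R) (measurableTypeR R) setT phi.
  exact: (@measurable_funM _ R R setT id (fun=> a^-1)).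
have ai0 : 0 <= a^-1 by rewrite invr_ge0 ltW.
(* Elaborated at these types, the measures [nu] and [nu'] are functions of a
   proof that [phi] is measurable. *)
pose nu : {measure set (measurableTypeR R) -> \bar R} :=
  pushforward lebesgue_measure (phi : measurableTypeR R -> measurableTypeR R).
pose nu' : {measure set (measurableTypeR R) -> \bar R} :=
  mscale (NngNum ai0) (pushforward lebesgue_measure
    (phi : measurableTypeR R -> measurableTypeR R)).
transitivity (\int[nu mphi]_t f t)%E.
  by rewrite /nu ge0_integral_pushforward// preimage_setT.
rewrite -(@ge0_integral_mscale _ _ R lebesgue_measure setT measurableT
  (NngNum (ltW a0)) f mf)//.
apply: eq_measure_integral => A mA _.
(* Lebesgue measure is characterised by its values on intervals ]x, y], whose
   preimages under [phi] are the intervals ]ax, ay]. *)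
have E : lebesgue_measure (A : set (measurableTypeR R)) = nu' mphi A.
  apply: (@lebesgue_measure_unique _ (nu' mphi)) => // _ [[x y] _ <-].
  change (lebesgue_measure (`]x, y]%classic : set (measurableTypeR R))
    = (a^-1)%:E *
      lebesgue_measure (phi @^-1` `]x, y]%classic : set (measurableTypeR R)))%E.
  have -> : phi @^-1` `]x, y]%classic = `]a * x, a * y]%classic.
    apply/seteqP; split=> t /=; rewrite !in_itv /= /phi;
      by rewrite ltr_pdivlMr// ler_pdivrMr// ![a * _]mulrC.
  rewrite !lebesgue_measure_itv /= !lte_fin ltr_pM2l//.
  case: ifP => _; last by rewrite mule0.
  rewrite !EFinM -!EFinB -!EFinM; congr (_%:E); field; lra.
transitivity (a%:E * lebesgue_measure (A : set (measurableTypeR R)))%E; last by [].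
rewrite E; transitivity (a%:E * ((a^-1)%:E * nu mphi A))%E; last by [].
by rewrite muleA -EFinM divff ?gt_eqF// mul1e.
Qed.

(** Substituting t = a u in the integral over the slices contributes one more
    factor a in each dimension. *)
Lemma volume_sqball_dilation (R : realType) (k : nat) (a s : R) : 0 < a ->
  volume (sqball k (a ^+ 2 * s)) = ((a ^+ k)%:E * volume (sqball k s))%E.
Proof.
move=> a0; elim: k s => [|k IH] s.
  rewrite expr0 mul1e /=; congr (_ %:E); rewrite !indicE; congr (_%:R).
  congr nat_of_bool; apply/idP/idP; rewrite !inE /sqball /= /dot !big_ord0;
    by rewrite pmulr_rge0// exprn_gt0.
rewrite !volume_sqballS.
have E (t : R) : a ^+ 2 * s - t ^+ 2 = a ^+ 2 * (s - (t / a) ^+ 2).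
  by field; lra.
under eq_integral do rewrite E IH.
rewrite ge0_integralZl//; last 3 first.
- apply: (measurableT_comp (nondecreasing_emeasurable (@volume_sqball_homo R k))).
  apply: measurable_funB => //; apply: measurable_funX.
  exact: measurable_funM.
- by move=> x _; exact: volume_ge0.
- by rewrite lee_fin exprn_ge0// ltW.
rewrite (@ge0_integral_dilation _ a (fun t => volume (sqball k (s - t ^+ 2))))//.
- by rewrite muleA -EFinM -exprSr.
- exact: (measurable_slice _ (@volume_sqball_homo R k)).
- by move=> t; exact: volume_ge0.
Qed.

Lemma volume_ball_dilation (R : realType) (k : nat) (m : R) : 0 < m ->
  volume [set x : 'rV[R]_k | enorm x <= m / 2]
  = ((m ^+ k)%:E * volume [set x : 'rV[R]_k | (enorm x <= 1 / 2)%R])%E.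
Proof.
move=> m0.
have E (r : R) : 0 <= r -> [set x : 'rV[R]_k | enorm x <= r] = sqball k (r ^+ 2).
  move=> r0; apply/seteqP; split=> x; rewrite /sqball /= -enormK;
    by rewrite ler_pXn2r// nnegrE// sqrtr_ge0.
rewrite !E ?divr_ge0 ?(ltW m0)// exprMn volume_sqball_dilation//.
by rewrite div1r.
Qed.

(** * Packing density of a linear image *)

(** For infinite x both sides are 0. *)
Lemma fineMl (R : realType) (r : R) (x : \bar R) : 0 < r ->
  fine (r%:E * x)%E = r * fine x.
Proof.
by case: x => [x||] r0 //=; rewrite ?(gt0_muley, gt0_muleNy) ?lte_fin ?mulr0.
Qed.

Lemma packing_density_mul_le (R : realType) (k : nat) (L : set 'rV[R]_k)
    (g : 'M[R]_k) : g \in unitmx -> min_norm L = 1 ->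
  0 < min_norm [set x *m g | x in L] ->
  min_norm [set x *m g | x in L] ^+ k <= `|\det g| ->
  packing_density [set x *m g | x in L] <= packing_density L.
Proof.
move=> gU L1 m0 mg; rewrite /packing_density lattice_det_mul// L1.
rewrite volume_ball_dilation// fineMl ?exprn_gt0//.
set V := fine _; have V0 : 0 <= V by rewrite fine_ge0// volume_ge0.
(* Division by 0 gives 0, so both densities vanish if there is no basis. *)
have [->|d0] := eqVneq (lattice_det L) 0; first by rewrite mulr0 invr0 !mulr0.
have g0 : 0 < `|\det g| by rewrite normr_gt0 -unitfE -unitmxE.
have {}d0 : 0 < lattice_det L by rewrite lt_neqAle eq_sym d0 lattice_det_ge0.
rewrite invfM mulrACA -[leRHS]mul1r ler_wpM2r// ?divr_ge0 ?(ltW d0)//.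
by rewrite ler_pdivrMr// mul1r.
Qed.

(** * Maximal equiangular tight frames *)

Theorem theorem4 (R : realType) (k n : nat) (c : R) (F : n.-tuple 'rV[R]_k)
    (hk : (3 < k)%N)
    (hF : maximal_unit_ETF c F)
    (hmin : min_norm (int_span F) = 1) :
  [/\ perfect_lattice (int_span F),
      eutactic_lattice (int_span F) &
      extreme (int_span F)].
Proof.
have [[c01 [kn Ffull [g g0 tight]] F1 Fc] nE] := hF.
set L := int_span F.
have Lz : zmod_closed [in L] := int_span_closed F.
have Llat : is_lattice L := lattice_isolated Lz hmin.
have LF i : L (tnth F i) := mem_int_span F i.
have Fspan (S : 'M[R]_k) : S^T = S -> S \in <<[tuple outer (tnth F i) | i < n]>>%VS.
  apply: free_sym_span nE S; first exact: equiangular_outer_free Fc.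
  by move=> _ /tnthP[i ->]; rewrite tnth_mktuple outer_sym.
have /finite_seqP[X0 X0E] := finite_unit_vectors Lz hmin.
pose X := undup X0.
have XP x : x \in X <-> L x /\ enorm x = 1.
  by rewrite mem_undup; have := congr1 (fun A : set _ => A x) X0E => /= <-.
have Xunit : [set` X] = unit_min_vectors L.
  rewrite /unit_min_vectors /min_vectors hmin invr1.
  apply/seteqP; split=> [x /= /XP[Lx x1]|_ [x /= [Lx x1] <-]].
    by exists x; rewrite ?scale1r.
  by rewrite scale1r; apply/XP.
have FX i : tnth F i \in X by apply/XP; split.
have Xsph : spherical X.
  split; [exact: undup_uniq| |by move=> x /XP[]].
  have XV : (<<F>> <= <<X>>)%VS by apply: sub_span => _ /tnthP[i ->].
  have := dimvS XV; rewrite Ffull dimvf /dim /= mul1n => /leq_trans; apply.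
  exact: dim_span.
split.
- by split=> //; exists X; split=> //; exact: perfect_superset Fspan FX.
- by split=> //; exists X; split=> //;
  exact: eutactic_superset g0 tight Fspan (undup_uniq _) FX.
split=> //.
  by exists F => // _ /tnthP[i ->].
have n0 : (0 < n)%N by exact: leq_ltn_trans kn.
have [d d0 hermite] := hermite_locally_maximal g0 (tight_sum_outer tight) Fspan F1 n0.
near=> h => hU.
have m0 : 0 < min_norm [set x *m h | x in L].
  apply: min_norm_mul_gt0; rewrite ?hmin//.
  by exists (tnth F (Ordinal n0)) => //; exact: enorm1_neq0.
apply: packing_density_mul_le => //.
(* Squared, the goal is a bound on the Gram determinant of [h]; the minimal
   norm of the image lattice is at most the length of each image of [F]. *)
set m := min_norm _ in m0 *.
rewrite -(ler_pXn2r (n := 2))// ?nnegrE ?exprn_ge0 ?(ltW m0)//.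
rewrite real_normK ?num_real// -exprM mulnC exprM expr2.
rewrite [leRHS]expr2 -[X in _ <= _ * X]det_tr -det_mulmx.
apply: hermite.
- by rewrite trmx_mul trmxK.
- by near: h; exact: near1_gram_close.
- by rewrite mulr_ge0// ltW.
move=> i; rewrite -expr2.
have -> : quad (tnth F i) (h *m h^T) = enorm (tnth F i *m h) ^+ 2.
  by rewrite enormK -mulmx_tr_dot /quad trmx_mul !mulmxA.
rewrite ler_pXn2r ?nnegrE ?sqrtr_ge0 ?(ltW m0)// min_norm_le//.
  by exists (tnth F i).
exact/mulmx_unit_neq0/enorm1_neq0.
Unshelve. all: by end_near.
Qed.
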